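(* Let $k\ge 2$. The set $S_\alpha=\{\alpha_0,\alpha_1,\alpha_2,\ldots,\alpha_{k-2},\tau\}$ of elements of $\mathrm{Aut}\,X^{[k]}$ generates the group $G_k$, which is isomorphic to a Sylow 2-subgroup of the alternating group $A_{2^k}$.
   Context: Let $X=\{0,1\}$ and let $X^{[k]}$ be the finite rooted binary tree with levels $X^0,\ldots,X^k$ ($X^l$ = words of length $l$; $v$ is joined to $vx$, $x\in X$). The vertices of $X^j$ are numbered from left to right $v_{j,1},\ldots,v_{j,2^j}$ (so $v_{j,1},\dots,v_{j,2^{j-1}}$ lie in the subtree below $v_{1,1}$). For $g\in \mathrm{Aut}\,X^{[k]}$ and a vertex $v$ of level $<k$, the section $g_{(v)}$ is defined by $g(vx)=g(v)g_{(v)}(x)$; its action on the first level below $v$ is the vertex permutation (v.p.) of $g$ at $v$, called active if it is nontrivial. For $0\le l\le k-2$, $\alpha_l$ is the automorphism whose only active v.p. is at $v_{l,1}$. $\tau=\tau_{1,2^{k-1}}$ is the automorphism whose only active v.p.'s are at $v_{k-1,1}$ and $v_{k-1,2^{k-1}}$. $B_{k-1}=\mathrm{Aut}\,X^{[k-1]}\simeq C_2\wr\cdots\wr C_2$ ($k-1$ factors) is viewed as the subgroup of $\mathrm{Aut}\,X^{[k]}$ of automorphisms having trivial v.p. at all vertices of $X^{k-1}$. $W_{k-1}$ is the subgroup of $\mathrm{Aut}\,X^{[k]}$ of automorphisms whose active v.p.'s all lie on $X^{k-1}$ and are even in number. $G_k=B_{k-1}\ltimes W_{k-1}$ is the subgroup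 of $\mathrm{Aut}\,X^{[k]}$ generated by $B_{k-1}$ and $W_{k-1}$ ($B_{k-1}$ acts on $W_{k-1}$ by conjugation). *)

(* Defs.v *)
From mathcomp Require Import all_boot all_fingroup all_solvable.

Set Implicit Arguments.
Unset Strict Implicit.
Unset Printing Implicit Defensive.

Import GroupScope.
Local Open Scope nat_scope.

(* The alphabet X = {0, 1} is bool, with 0 = false and 1 = true.  The tree
   X^[k] has as vertices the words of length at most k; the root is the empty
   word. *)
Notation vertex k := {bseq k of bool}.

Section Tree.

Variable k : nat.
Implicit Types (u v : vertex k) (g h : {perm vertex k}) (x : bool).

(* The vertex vx; only meaningful when size v < k. *)
Definition child v x : vertex k := insub_bseq k (rcons v x).

Definition joined u v : bool :=
  [exists x, (v == rcons u x :> seq bool) || (u == rcons v x :> seq bool)].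

(* Aut X^[k] as a permutation group on the vertices: rooted graph
   automorphisms. *)
Definition Aut_tree : {set {perm vertex k}} :=
  [set g : {perm vertex k} | (g [bseq] == [bseq]) &&
           [forall u, forall v, joined (g u) (g v) == joined u v]].

(* The v.p. of g at v: vp g v x is the letter y such that g(vx) = g(v)y
   (see vpE); only meaningful when size v < k. *)
Definition vp g v x : bool := last x (g (child v x)).

Definition active g : {set vertex k} :=
  [set v : vertex k | (size v < k) && [exists x, vp g v x != x]].

Lemma Aut_tree_group_set : group_set Aut_tree.
Proof.
apply/group_setP; split=> [|g h].
  rewrite inE perm1 eqxx /=; apply/forallP=> u; apply/forallP=> v.
  by rewrite !perm1.
rewrite !inE => /andP[/eqP g0 /forallP gE] /andP[/eqP h0 /forallP hE].
rewrite permM g0 h0 eqxx /=; apply/forallP=> u; apply/forallP=> v.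
have /forallP/(_ (g v))/eqP hE' := hE (g u).
by have /forallP/(_ v)/eqP gE' := gE u; rewrite !permM hE' gE'.
Qed.
Canonical Aut_tree_group := Group Aut_tree_group_set.

Lemma child_val v x : size v < k -> child v x = rcons v x :> seq bool.
Proof. by move=> v_lt; rewrite /child /insub_bseq insubdK // -topredE /= size_rcons. Qed.

Lemma vertex_ind (P : vertex k -> Prop) :
    P [bseq] -> (forall v x, size v < k -> P v -> P (child v x)) ->
  forall v, P v.
Proof.
move=> P0 PS [s]; elim/last_ind: s => [|s x IHs] s_le.
  by rewrite (_ : Bseq _ = [bseq]) //; apply/val_inj.
have s_lt : size s < k by rewrite size_rcons in s_le.
rewrite (_ : Bseq _ = child (Bseq (ltnW s_lt)) x); first exact: PS.
by apply/val_inj; rewrite /= child_val.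
Qed.

Lemma vpE g v x : g \in Aut_tree -> size v < k ->
  g (child v x) = rcons (g v) (vp g v x) :> seq bool.
Proof.
rewrite inE => /andP[/eqP g0 /forallP gE].
have gJ u w : joined (g u) (g w) = joined u w.
  by have /forallP/(_ w)/eqP := gE u.
have Jch (w : vertex k) y : size w < k -> joined w (child w y).
  by move=> w_lt; apply/existsP; exists y; rewrite child_val ?eqxx.
have vpP (w : vertex k) y z : g (child w y) = rcons (g w) z :> seq bool ->
    g (child w y) = rcons (g w) (vp g w y) :> seq bool.
  by rewrite /vp => ->; rewrite last_rcons.
elim/vertex_ind: v x => [|v z v_lt IHv] x v_le.
  have := Jch _ x v_le; rewrite -gJ g0 => /existsP[y /orP[]/eqP e].
    by rewrite (@vpP _ x y) ?g0.
  by case: (val (g _)) e.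
have := Jch _ x v_le; rewrite -gJ => /existsP[y /orP[]/eqP e].
  exact: vpP e.
have := IHv z v_lt; rewrite e => /rcons_inj[e1 _].
have /perm_inj/(congr1 (fun w : vertex k => size w)) : g (child (child v z) x) = g v.
  exact: val_inj.
rewrite /= child_val // size_rcons child_val // size_rcons => /eqP.
by rewrite -addn2 -[X in _ == X]addn0 eqn_add2l.
Qed.

(* The automorphism that is active exactly at the vertices of level < k listed
   in P (see active_tree_aut and active_inj): letter m of a word s is switched
   iff the prefix of s of length m is in P. *)
Definition switch (P : seq (seq bool)) (s : seq bool) : seq bool :=
  mkseq (fun m => nth false s m (+) (take m s \in P)) (size s).

Lemma size_switch P s : size (switch P s) = size s.
Proof. exact: size_mkseq. Qed.

Lemma switch_rcons P s x :
  switch P (rcons s x) = rcons (switch P s) (x (+) (s \in P)).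
Proof.
rewrite /switch size_rcons /mkseq -addn1 iotaD map_cat /= add0n cats1.
congr rcons; last by rewrite nth_rcons ltnn eqxx -cats1 take_size_cat.
apply/eq_in_map=> m; rewrite mem_iota /= add0n => m_lt.
by rewrite nth_rcons m_lt -cats1 takel_cat // ltnW.
Qed.

Lemma switch_inj P : injective (switch P).
Proof.
move=> s t; elim/last_ind: s t => [|s x IHs] t; case/lastP: t => [|t y] //.
- by move/(congr1 size); rewrite !size_switch size_rcons.
- by move/(congr1 size); rewrite !size_switch size_rcons.
by rewrite !switch_rcons => /rcons_inj[/IHs-> /addIb->].
Qed.

Definition switch_vertex P v : vertex k := insub_bseq k (switch P v).

Lemma switch_vertex_val P v : switch_vertex P v = switch P v :> seq bool.
Proof.
by rewrite /switch_vertex /insub_bseq insubdK // -topredE /= size_switch size_bseq.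
Qed.

Lemma switch_vertex_inj P : injective (switch_vertex P).
Proof.
move=> u v /(congr1 val) /=; rewrite !switch_vertex_val => /switch_inj.
exact: val_inj.
Qed.

Definition tree_aut P : {perm vertex k} := perm (@switch_vertex_inj P).

Lemma tree_autE P v : tree_aut P v = switch P v :> seq bool.
Proof. by rewrite permE switch_vertex_val. Qed.

Lemma tree_aut_Aut P : tree_aut P \in Aut_tree.
Proof.
rewrite inE -val_eqE /= tree_autE eqxx /=.
have sP (s t : seq bool) : [exists x, switch P t == rcons (switch P s) x] =
    [exists x, t == rcons s x].
  apply/existsP/existsP=> -[x /eqP e].
    exists (x (+) (s \in P)); apply/eqP/(@switch_inj P).
    by rewrite e switch_rcons addbK.
  by exists (x (+) (s \in P)); rewrite e switch_rcons.
have JE (s t : seq bool) : [exists x, (t == rcons s x) || (s == rcons t x)] =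
    [exists x, t == rcons s x] || [exists x, s == rcons t x].
  apply/existsP/orP=> [[x /orP[]] e|[]/existsP[x e]].
  - by left; apply/existsP; exists x.
  - by right; apply/existsP; exists x.
  - by exists x; rewrite e.
  - by exists x; rewrite e orbT.
apply/forallP=> u; apply/forallP=> v.
by rewrite /joined !tree_autE !JE !sP.
Qed.

Lemma active_tree_aut P :
  active (tree_aut P) = [set v : vertex k | (size v < k) && (val v \in P)].
Proof.
apply/setP=> v; rewrite !inE; case: ltnP => //= v_lt.
have vE x : vp (tree_aut P) v x = x (+) (val v \in P).
  by rewrite /vp tree_autE child_val // switch_rcons last_rcons.
apply/existsP/idP=> [[x]|vP]; last by exists false; rewrite vE vP.
by rewrite vE; case: (_ \in P); rewrite ?addbF ?eqxx.
Qed.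

Lemma active_inj : {in Aut_tree &, injective active}.
Proof.
move=> g h gA hA gh; apply/permP; elim/vertex_ind => [|v x v_lt IHv].
  by move: gA hA; rewrite !inE => /andP[/eqP-> _] /andP[/eqP-> _].
apply/val_inj; rewrite /= !vpE //= IHv; congr rcons.
have vpI f : f \in Aut_tree -> injective (vp f v).
  move=> fA y z e; have : f (child v y) = f (child v z).
    by apply/val_inj; rewrite /= !vpE // e.
  by move/perm_inj/(congr1 val); rewrite /= !child_val // => /rcons_inj[].
have vpA f : f \in Aut_tree -> vp f v x = x (+) (v \in active f).
  move=> /vpI fI; rewrite inE v_lt /=.
  have fN : vp f v true = ~~ vp f v false.
    by have := inj_eq fI true false; case: (vp f v true); case: (vp f v false).
  apply/esym; case: existsP => [[y]|nA].
    by case: y x fN => -[]; case: (vp f v true); case: (vp f v false).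
  by rewrite addbF; case: (eqVneq (vp f v x) x) => // fx; case: nA; exists x.
by rewrite !vpA // gh.
Qed.

End Tree.

(* The vertex v_{j,i} (1 <= i <= 2^j): its letters are the j binary digits of
   i - 1, the most significant one being the first. *)
Definition vtx (j i : nat) : seq bool :=
  mkseq (fun m => odd (i.-1 %/ 2 ^ (j - m.+1))) j.

Lemma vtx_leftmost j : vtx j 1 = nseq j false.
Proof.
apply: (@eq_from_nth _ false) => [|m]; rewrite size_mkseq ?size_nseq // => m_lt.
by rewrite nth_mkseq // nth_nseq m_lt div0n.
Qed.

Lemma vtx_rightmost j : vtx j (2 ^ j) = nseq j true.
Proof.
apply: (@eq_from_nth _ false) => [|m]; rewrite size_mkseq ?size_nseq // => m_lt.
rewrite nth_mkseq // nth_nseq m_lt.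
have -> : (2 ^ j).-1 = ((2 ^ m.+1).-1 * 2 ^ (j - m.+1) + (2 ^ (j - m.+1)).-1)%N.
  have e : (2 ^ m.+1 * 2 ^ (j - m.+1) = 2 ^ j)%N by rewrite -expnD subnKC.
  rewrite -e; case: (2 ^ m.+1)%N (expn_gt0 2 m.+1) => // a _.
  case: (2 ^ (j - m.+1))%N (expn_gt0 2 (j - m.+1)) => // b _.
  by rewrite mulSn addnC /= addnS.
rewrite divnMDl ?expn_gt0 // divn_small ?prednK ?expn_gt0 // addn0.
by rewrite expnS mul2n -(prednK (expn_gt0 2 m)) doubleS /= odd_double.
Qed.

Definition alpha (k l : nat) : {perm vertex k} := tree_aut k [:: vtx l 1].

Definition tau (k : nat) : {perm vertex k} :=
  tree_aut k [:: vtx k.-1 1; vtx k.-1 (2 ^ k.-1)].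

Definition S_alpha (k : nat) : {set {perm vertex k}} :=
  [set alpha k l | l : 'I_k.-1] :|: [set tau k].

(* B k and W k are the groups written B_{k-1} and W_{k-1}, as subsets of
   Aut X^[k]. *)
Definition B (k : nat) : {set {perm vertex k}} :=
  [set g : {perm vertex k} in Aut_tree k | [forall v : vertex k in active g, size v != k.-1]].

Definition W (k : nat) : {set {perm vertex k}} :=
  [set g : {perm vertex k} in Aut_tree k |
    [forall v : vertex k in active g, size v == k.-1] && ~~ odd #|active g|].

Definition G (k : nat) : {group {perm vertex k}} := (B k <*> W k)%G.

(* Main.v *)
Require Import Defs.
From mathcomp Require Import all_boot all_fingroup all_solvable.

Set Implicit Arguments.
Unset Strict Implicit.
Unset Printing Implicit Defensive.

Import GroupScope.
Local Open Scope nat_scope.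

(** An automorphism of the tree is determined by its portrait, the set
    [active g] of vertices with a nontrivial vertex permutation, and every set
    of inner vertices is a portrait. Everything below is computed on portraits
    from the cocycle rule [activeM]: a vertex v is active for the composite of
    g and then h iff exactly one of v being active for g and g v being active
    for h holds.

    Generation. Call g even if its portrait meets the bottom inner level
    X^(k-1) in an even number of vertices. B and W consist of even elements,
    and contain the generators, so it is enough that <<S_alpha>> contains every
    even automorphism. Multiplying g on the right by elements of <<S_alpha>>
    strips its portrait ([strip_ind]), so only two kinds of elements are
    needed: those active at a single vertex of level < k - 1 ([flip_gen]), and
    those active at a pair of vertices of X^(k-1) ([pair_gen]). The former are
    conjugates of the alpha_l, by elements that move a given vertex to the
    leftmost one of its level; the latter come from tau by conjugation, except
    that two vertices in the same half of the tree are joined through a vertex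
    of the other half.

    Sylow subgroup. The action on the 2^k leaves embeds Aut X^[k] into
    Sym(2^k). Counting portraits gives |Aut X^[k]| = 2^(2^k - 1), which is the
    2-part of (2^k)!, so the image is a Sylow 2-subgroup of Sym(2^k)
    ([leaf_perm_Sylow_Sym]), and its intersection with the normal subgroup
    Alt(2^k) is a Sylow 2-subgroup of Alt(2^k). This intersection is the image
    of G ([leaf_perm_in_Alt]): an element acting only above X^(k-1) does the
    same on the leaves ending in 0 and on those ending in 1, so it is even on
    leaves, while a single active vertex of X^(k-1) is a transposition of
    leaves. *)

(** * Portraits of tree automorphisms *)

Section Portraits.

Variable k : nat.
Implicit Types (u v w : vertex k) (g h : {perm vertex k}) (x : bool).
Implicit Types A C : {set vertex k}.

Definition inner : {set vertex k} := [set v : vertex k | size v < k].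

Lemma active_inner g : active g \subset inner.
Proof. by apply/subsetP=> v; rewrite !inE => /andP[]. Qed.

Lemma Aut_root g : g \in Aut_tree k -> g [bseq] = [bseq].
Proof. by rewrite inE => /andP[/eqP]. Qed.

Lemma Aut_child g v x : g \in Aut_tree k -> size v < k ->
  g (child v x) = rcons (g v) (x (+) (v \in active g)) :> seq bool.
Proof.
move=> gA v_lt; rewrite vpE //; congr rcons.
have vp_inj : injective (vp g v).
  move=> y z e; have : g (child v y) = g (child v z).
    by apply/val_inj; rewrite /= !vpE // e.
  by move/perm_inj/(congr1 val); rewrite /= !child_val // => /rcons_inj[].
rewrite inE v_lt /=.
have vpN : vp g v true = ~~ vp g v false.
  by have := inj_eq vp_inj true false; case: (vp g v true); case: (vp g v false).
apply/esym; case: existsP => [[y]|nA].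
  by case: y x vpN => -[]; case: (vp g v true); case: (vp g v false).
by rewrite addbF; case: (eqVneq (vp g v x) x) => // gx; case: nA; exists x.
Qed.

Lemma Aut_size g v : g \in Aut_tree k -> size (g v) = size v.
Proof.
move=> gA; elim/vertex_ind: v => [|v x v_lt IHv]; first by rewrite Aut_root.
by rewrite Aut_child // child_val // !size_rcons IHv.
Qed.

(** The vertex permutations of g at v and of h at g v compose, and two switches
    of a letter cancel. *)
Lemma activeM g h v : g \in Aut_tree k -> h \in Aut_tree k ->
  (v \in active (g * h)%g) = (v \in active g) (+) (g v \in active h).
Proof.
move=> gA hA; case: (ltnP (size v) k) => v_lt; last first.
  by rewrite !inE Aut_size // ltnNge v_lt.
have gv_lt : size (g v) < k by rewrite Aut_size.
have e : g (child v false) = child (g v) (v \in active g).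
  by apply/val_inj; rewrite /= Aut_child // child_val.
have := Aut_child false (groupM gA hA) v_lt.
by rewrite !permM e Aut_child // => /rcons_inj[].
Qed.

Lemma active1 : active (1 : {perm vertex k})%g = set0.
Proof.
apply/setP=> v; rewrite !inE; apply/negP=> /andP[v_lt /existsP[x]].
by rewrite /vp perm1 child_val // last_rcons eqxx.
Qed.

Lemma Aut_fix n g v : g \in Aut_tree k -> {in active g, forall w, n <= size w} ->
  size v <= n -> g v = v.
Proof.
move=> gA gn; elim/vertex_ind: v => [|v x v_lt IHv]; first by rewrite Aut_root.
rewrite child_val // size_rcons => v_ltn; apply/val_inj.
rewrite /= Aut_child // child_val // IHv ?(ltnW v_ltn) //.
suff /negPf-> : v \notin active g by rewrite addbF.
by apply/negP => /gn; rewrite leqNgt v_ltn.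
Qed.

(** As g fixes the levels up to n, and h is inactive from level n on, h is
    active at g w iff it is at w, so its contributions to the cocycle cancel. *)
Lemma active_conj n g h : g \in Aut_tree k -> h \in Aut_tree k ->
    {in active g, forall w, n <= size w} ->
    {in active h, forall w, size w < n} ->
  active (g ^ h)%g = h @: active g.
Proof.
move=> gA hA gn hn; apply/setP=> v; rewrite -(permKV h v) mem_imset; last exact: perm_inj.
move: (h^-1%g v) => w; have := activeM w hA (groupJ gA hA).
rewrite -conjgC activeM //.
suff -> : (g w \in active h) = (w \in active h).
  by rewrite addbC => /addbI <-.
case: (ltnP (size w) n) => w_n; first by rewrite (Aut_fix gA gn) // ltnW.
have le_notin (z : vertex k) : size z = size w -> (z \in active h) = false.
  by move=> zw; apply/negP=> /hn; rewrite zw ltnNge w_n.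
by rewrite !le_notin // Aut_size.
Qed.

Definition activate A : {perm vertex k} := tree_aut k [seq val v | v <- enum A].

Lemma activate_Aut A : activate A \in Aut_tree k.
Proof. exact: tree_aut_Aut. Qed.

Lemma active_activate A : A \subset inner -> active (activate A) = A.
Proof.
move=> /subsetP sA; rewrite active_tree_aut; apply/setP=> v.
rewrite inE mem_map; last exact: val_inj.
by rewrite mem_enum andb_idl // => /sA; rewrite inE.
Qed.

Lemma activeK g : g \in Aut_tree k -> activate (active g) = g.
Proof.
by move=> gA; apply: active_inj; rewrite ?activate_Aut // active_activate ?active_inner.
Qed.

Lemma activate_conj n A h : A \subset inner -> h \in Aut_tree k ->
    {in A, forall w, n <= size w} -> {in active h, forall w, size w < n} ->
  (activate A ^ h)%g = activate (h @: A).
Proof.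
move=> sA hA An hn; rewrite -[LHS]activeK ?groupJ ?activate_Aut //.
by rewrite (@active_conj n) ?activate_Aut ?active_activate.
Qed.

Lemma Aut_imset_inner g A :
  g \in Aut_tree k -> A \subset inner -> g @: A \subset inner.
Proof.
move=> gA /subsetP sA; apply/subsetP=> _ /imsetP[v /sA v_in ->].
by move: v_in; rewrite !inE Aut_size.
Qed.

Lemma active_mul_activate g A : g \in Aut_tree k -> A \subset inner ->
  active (g * activate (g @: A))%g = [set v | (v \in active g) (+) (v \in A)].
Proof.
move=> gA sA; apply/setP=> v; rewrite activeM ?activate_Aut // in_set.
by rewrite active_activate ?Aut_imset_inner // mem_imset //; apply: perm_inj.
Qed.

Lemma active_strip g A : g \in Aut_tree k -> A \subset active g ->
  active (g * activate (g @: A))%g = active g :\: A.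
Proof.
move=> gA sA; rewrite active_mul_activate //; last first.
  exact: subset_trans sA (active_inner g).
apply/setP=> v; rewrite in_setD in_set; have := subsetP sA v.
by case: (v \in A) => [-> //|_]; rewrite addbF.
Qed.

(** Induction on the size of the portrait: multiplying g by an element of H
    active on the image of A removes A from the portrait of g. The invariant C
    on portraits says which vertices may still be stripped. *)
Lemma strip_ind (H : {group {perm vertex k}}) (C : {set vertex k} -> Prop) :
    (forall g, g \in Aut_tree k -> C (active g) -> active g != set0 ->
      exists A : {set vertex k}, [/\ A \subset active g, A != set0,
        activate (g @: A) \in H & C (active g :\: A)]) ->
  forall g, g \in Aut_tree k -> C (active g) -> g \in H.
Proof.
move=> step g; have [n] := ubnP #|active g|; elim: n g => // n IHn g g_lt gA gC.
have [g0|/(step g gA gC)[A [sA A0 AH AC]]] := eqVneq (active g) set0.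
  suff -> : g = 1%g by apply: group1.
  by apply: active_inj; rewrite ?group1 // active1.
rewrite -(groupMr _ AH); apply: IHn.
- rewrite active_strip // -ltnS (leq_trans _ g_lt) // !ltnS.
  have:= cardsID A (active g); rewrite (setIidPr sA) => <-.
  by rewrite -[X in X < _]add0n ltn_add2r card_gt0.
- by rewrite groupM ?activate_Aut.
- by rewrite active_strip.
Qed.

Lemma flips_generate (H : {group {perm vertex k}}) n g :
    {in inner, forall v, size v < n -> activate [set v] \in H} ->
    g \in Aut_tree k -> {in active g, forall v, size v < n} ->
  g \in H.
Proof.
move=> flipH.
apply: (@strip_ind H (fun A => {in A, forall v, size v < n})) => {}g gA gn.
case/set0Pn=> v v_act; exists [set v]; split.
- by rewrite sub1set.
- by apply/set0Pn; exists v; rewrite set11.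
- rewrite imset_set1; have := v_act; rewrite inE => /andP[v_lt _].
  by apply: flipH; rewrite ?inE Aut_size // gn.
- by move=> w /setDP[/gn].
Qed.

(** The portrait along the path to s that turns every letter 1 of s into 0: a
    prefix is active iff the letter of s that follows it is 1. *)
Definition prefixes_before_one (s : seq bool) : seq (seq bool) :=
  [seq take m s | m <- iota 0 (size s) & nth false s m].

Lemma mem_prefixes_before_one s t : (t \in prefixes_before_one s) =
  [&& t == take (size t) s, size t < size s & nth false s (size t)].
Proof.
apply/mapP/and3P=> [[m]|[/eqP t_pre t_lt tN]]; last first.
  by exists (size t); rewrite // mem_filter tN mem_iota.
rewrite mem_filter mem_iota add0n /= => /andP[sm m_lt] ->.
by rewrite size_take m_lt eqxx.
Qed.

Lemma switch_to_leftmost s :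
  switch (prefixes_before_one s) s = nseq (size s) false.
Proof.
apply: (@eq_from_nth _ false) => [|m]; rewrite size_switch ?size_nseq // => m_lt.
rewrite nth_mkseq // nth_nseq m_lt mem_prefixes_before_one.
by rewrite size_take m_lt eqxx m_lt addbb.
Qed.

(** The active prefixes are nonempty, hence start with 0, and are not met on a
    path that starts with 1. *)
Lemma switch_other_half s t :
  switch (prefixes_before_one (false :: s)) (true :: t) = true :: t.
Proof.
apply: (@eq_from_nth _ false) => [|m]; rewrite size_switch // => m_lt.
rewrite nth_mkseq // mem_prefixes_before_one size_take m_lt.
by case: m m_lt => [|m] //= m_lt; rewrite ?andbF addbF.
Qed.

Definition to_leftmost v : {perm vertex k} := tree_aut k (prefixes_before_one v).

Lemma to_leftmost_Aut v : to_leftmost v \in Aut_tree k.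
Proof. exact: tree_aut_Aut. Qed.

Lemma to_leftmostE v : to_leftmost v v = nseq (size v) false :> seq bool.
Proof. by rewrite tree_autE switch_to_leftmost. Qed.

Lemma active_to_leftmost v : {in active (to_leftmost v), forall w, size w < size v}.
Proof.
by move=> w; rewrite active_tree_aut inE mem_prefixes_before_one => /and4P[].
Qed.

End Portraits.

(** * The group generated by the alpha_l and tau *)

Section Generation.

Variable k : nat.
Hypothesis k_ge2 : 2 <= k.
Implicit Types (u v w : vertex k) (g h : {perm vertex k}) (x : bool).
Implicit Types A C : {set vertex k}.

Let k_gt0 : 0 < k. Proof. exact: ltnW. Qed.

Definition bottom : {set vertex k} := [set v : vertex k | size v == k.-1].

Lemma bottom_inner : bottom \subset inner k.
Proof. by apply/subsetP=> v; rewrite !inE => /eqP->; rewrite prednK. Qed.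

Lemma inner_bottom v : v \in inner k -> v \notin bottom -> size v < k.-1.
Proof. by rewrite !inE => v_lt vN; rewrite ltn_neqAle vN -ltnS prednK. Qed.

Lemma pair_inner u v : u \in bottom -> v \in bottom -> [set u; v] \subset inner k.
Proof. by move=> uB vB; rewrite subUset !sub1set !(subsetP bottom_inner). Qed.

Lemma Aut_bottom g v : g \in Aut_tree k -> (g v \in bottom) = (v \in bottom).
Proof. by move=> gA; rewrite !inE Aut_size. Qed.

Lemma bottom_fix A v : A \subset bottom -> v \in bottom -> activate A v = v.
Proof.
move=> AB vB; apply: (@Aut_fix _ k.-1); rewrite ?activate_Aut //.
  move=> w; rewrite active_activate ?(subset_trans AB bottom_inner) //.
  by move/(subsetP AB); rewrite inE => /eqP->.
by move: vB; rewrite inE => /eqP->.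
Qed.

(** Switching on X^(k-1) moves leaves only, so that the cocycle rule becomes
    symmetric difference. *)
Lemma activate_bottomM A C : A \subset bottom -> C \subset bottom ->
  (activate A * activate C)%g = activate [set v | (v \in A) (+) (v \in C)].
Proof.
move=> AB CB; have sub (D : {set vertex k}) : D \subset bottom -> D \subset inner k.
  by move=> DB; apply: subset_trans DB bottom_inner.
rewrite -[LHS]activeK ?groupM ?activate_Aut //; congr activate.
apply/setP=> v; rewrite activeM ?activate_Aut // !active_activate ?sub // in_set.
have [vB|vB] := boolP (v \in bottom); first by rewrite bottom_fix.
rewrite !(contraNF (subsetP CB _)) // Aut_bottom //; exact: activate_Aut.
Qed.

Definition const_vertex x : vertex k := insub_bseq k (nseq k.-1 x).

Lemma const_vertexE x : const_vertex x = nseq k.-1 x :> seq bool.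
Proof.
by rewrite /const_vertex /insub_bseq insubdK // -topredE /= size_nseq leq_pred.
Qed.

Lemma const_vertex_bottom x : const_vertex x \in bottom.
Proof. by rewrite inE const_vertexE size_nseq. Qed.

Lemma const_vertex_neq : const_vertex false != const_vertex true.
Proof. by rewrite -val_eqE /= !const_vertexE; case: k k_ge2 => [|[|n]]. Qed.

Lemma bottom_cons v : v \in bottom -> exists x s, v = x :: s :> seq bool.
Proof.
rewrite inE; case: k k_ge2 v => [|[|n]] // _ v /=.
by case: (val v) => [|x s] // _; exists x, s.
Qed.

Lemma alphaE v : v \in inner k -> v = nseq (size v) false :> seq bool ->
  activate [set v] = alpha k (size v).
Proof.
move=> v_in v0; apply: active_inj; rewrite ?activate_Aut ?tree_aut_Aut //.
rewrite active_activate ?sub1set // active_tree_aut vtx_leftmost -v0.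
apply/setP=> w; rewrite !inE (inj_eq val_inj) andb_idl // => /eqP->.
by rewrite inE in v_in.
Qed.

Lemma tauE : tau k = activate [set const_vertex false; const_vertex true].
Proof.
apply: active_inj; rewrite ?activate_Aut ?tree_aut_Aut //.
rewrite active_activate ?pair_inner ?const_vertex_bottom //.
rewrite active_tree_aut vtx_leftmost vtx_rightmost -!const_vertexE.
apply/setP=> w; rewrite !inE !(inj_eq val_inj) andb_idl //.
by case/orP=> /eqP->; rewrite const_vertexE size_nseq prednK.
Qed.

Let K := <<S_alpha k>>%G.

Lemma alpha_gen l : l < k.-1 -> alpha k l \in K.
Proof.
move=> l_lt; apply/mem_gen/setUP; left.
by apply/imsetP; exists (Ordinal l_lt).
Qed.

(** By induction on the level: the element moving v to the leftmost vertex of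
    its level is active only above v, hence it is already generated, and it
    conjugates the switch at v to some alpha_l. *)
Lemma flip_gen v : size v < k.-1 -> activate [set v] \in K.
Proof.
have [n] := ubnP (size v); elim: n v => // n IHn v v_le v_lt.
have v_in : v \in inner k by rewrite inE (leq_trans v_lt) ?leq_pred.
have hA := to_leftmost_Aut v; set h := to_leftmost v in hA.
have hK : h \in K.
  apply: (flips_generate _ hA (@active_to_leftmost _ v)) => w _ w_lt.
  by apply: IHn; [apply: leq_trans w_lt _ | apply: ltn_trans w_lt _].
rewrite -(groupJr _ hK) (@activate_conj _ (size v)) ?sub1set //; last 2 first.
- by move=> w /set1P->.
- exact: active_to_leftmost.
rewrite imset_set1 alphaE ?Aut_size //; first exact: alpha_gen.
- by move: v_in; rewrite !inE Aut_size.
- exact: to_leftmostE.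
Qed.

Lemma upper_gen h : h \in Aut_tree k -> {in active h, forall v, size v < k.-1} ->
  h \in K.
Proof. by apply: flips_generate => v _; apply: flip_gen. Qed.

Lemma pair_gen_conj u v h : u \in bottom -> v \in bottom ->
    h \in Aut_tree k -> {in active h, forall v, size v < k.-1} ->
  (activate [set h u; h v] \in K) = (activate [set u; v] \in K).
Proof.
move=> uB vB hA h_up; rewrite -[RHS](groupJr _ (upper_gen hA h_up)).
rewrite (@activate_conj _ k.-1) ?imsetU1 ?imset_set1 //.
- exact: pair_inner.
- by move=> w /set2P[]->; [move: uB | move: vB]; rewrite inE => /eqP->.
Qed.

Lemma pair_gen_trans u v w : u \in bottom -> v \in bottom -> w \in bottom ->
    u != v -> v != w -> u != w ->
  activate [set u; v] \in K -> activate [set v; w] \in K ->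
  activate [set u; w] \in K.
Proof.
move=> uB vB wB uv vw uw.
suff -> : activate [set u; w] = (activate [set u; v] * activate [set v; w])%g.
  exact: groupM.
rewrite activate_bottomM ?subUset ?sub1set ?uB ?vB ?wB //; congr activate.
apply/setP=> z; rewrite !inE; have [->|] := eqVneq z u.
  by rewrite (negPf uv) (negPf uw).
by have [->|] := eqVneq z v; rewrite ?(negPf vw).
Qed.

(** Say that u and v are linked if the pair {u, v} is generated, and let r be
    the rightmost vertex of X^(k-1). Vertices of the left half are linked to r
    by moving them to the leftmost vertex with r fixed. A vertex w of the right
    half is linked to alpha_0 r, because alpha_0 w, in the left half, is linked
    to r; and alpha_0 r is linked to r for the same reason. *)
Lemma pair_gen u v : u \in bottom -> v \in bottom -> u != v ->
  activate [set u; v] \in K.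
Proof.
set r := const_vertex true; have rB : r \in bottom := const_vertex_bottom true.
have left_gen w : w \in bottom -> ~~ head true w -> activate [set w; r] \in K.
  move=> wB w0.
  rewrite -(@pair_gen_conj _ _ (to_leftmost w)) ?to_leftmost_Aut //; last first.
    by move=> z /active_to_leftmost; move: wB; rewrite inE => /eqP->.
  suff [-> ->] : to_leftmost w w = const_vertex false /\ to_leftmost w r = r.
    by rewrite -tauE; apply/mem_gen/setUP; right; rewrite set11.
  split; apply/val_inj; rewrite /=.
    by rewrite to_leftmostE const_vertexE; move: wB; rewrite inE => /eqP->.
  rewrite tree_autE; have [y [t rE]] := bottom_cons rB.
  have [x [s wE]] := bottom_cons wB; move: w0; rewrite wE rE /=.
  have -> : y = true.
    by have := const_vertexE true; rewrite rE; case: k.-1 => //= n [].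
  by case: x wE => // wE _; apply: switch_other_half.
pose a := alpha k 0; have aA : a \in Aut_tree k := tree_aut_Aut k _.
have a_up : {in active a, forall z : vertex k, size z < k.-1}.
  move=> z; rewrite active_tree_aut inE vtx_leftmost mem_seq1 => /andP[_ /eqP->].
  by rewrite -ltnS prednK.
have aE w x s : w = x :: s :> seq bool -> a w = ~~ x :: s :> seq bool.
  move=> wE; rewrite tree_autE wE vtx_leftmost; apply: (@eq_from_nth _ false).
    by rewrite size_switch.
  move=> m; rewrite size_switch => m_lt; rewrite nth_mkseq // mem_seq1.
  by case: m m_lt => [|m] m_lt; rewrite /= ?eqxx ?addbT // addbF.
have aN w : w \in bottom -> head true (a w) = ~~ head true w.
  by move=> wB; have [x [s wE]] := bottom_cons wB; rewrite (aE _ _ _ wE) wE.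
have aBE w : w \in bottom -> a w \in bottom by rewrite Aut_bottom.
have right_gen w : w \in bottom -> w != r -> activate [set w; r] \in K.
  move=> wB wr; case w0: (head true w); last by rewrite left_gen ?w0.
  have r1 : head true r.
    by rewrite const_vertexE; case: k.-1.
  (* Conjugating by a, the claim is about a w, in the left half, and a (a r) = r. *)
  have w_ar : activate [set w; a r] \in K.
    rewrite -(@pair_gen_conj _ _ a) ?aBE //.
    suff -> : a (a r) = r by rewrite left_gen ?aBE ?aN ?w0.
    have [x [s rE]] := bottom_cons rB; apply: (@val_inj _ _ (vertex k)).
    by rewrite /= (aE _ _ _ (aE _ _ _ rE)) negbK.
  apply: (@pair_gen_trans _ (a r)); rewrite ?aBE //.
  - by apply: contraTneq w0 => ->; rewrite aN // r1.
  - by apply: contraTneq r1 => e; have := aN r rB; rewrite e; case: head.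
  - by rewrite left_gen ?aBE // aN // r1.
move=> uB vB uv; have [ur|ur] := eqVneq u r.
  by rewrite ur setUC right_gen // -ur eq_sym.
have [vr|vr] := eqVneq v r; first by rewrite vr right_gen.
apply: (@pair_gen_trans _ r); rewrite // 1?[r == v]eq_sym //; first exact: right_gen.
by rewrite setUC right_gen.
Qed.

(** Active vertices above X^(k-1) are stripped one at a time, then those of
    X^(k-1) two at a time. *)
Lemma even_bottom_gen g : g \in Aut_tree k -> ~~ odd #|active g :&: bottom| -> g \in K.
Proof.
apply: (@strip_ind _ _ (fun A => ~~ odd #|A :&: bottom|)) => {}g gA g_even g0.
have [gB|/subsetPn[v v_act vB]] := boolP (active g \subset bottom); last first.
  exists [set v]; rewrite sub1set; split=> //.
  - by apply/set0Pn; exists v; rewrite set11.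
  - rewrite imset_set1 flip_gen // Aut_size //.
    by rewrite inner_bottom // (subsetP (active_inner g)).
  - rewrite setIDAC (_ : _ :\ v = active g :&: bottom) //.
    by apply/setDidPl; rewrite disjoint_sym disjoints1 in_setI (negPf vB) andbF.
have [v v_act] := set0Pn _ g0.
have : active g :\ v != set0.
  apply: contraNneq g_even => e.
  by rewrite (setIidPl gB) (cardsD1 v) v_act e cards0.
case/set0Pn=> w /setD1P[wv w_act].
exists [set v; w]; rewrite subUset !sub1set v_act w_act; split=> //.
- by apply/set0Pn; exists v; rewrite !inE eqxx.
- rewrite imsetU1 imset_set1 pair_gen ?Aut_bottom ?(subsetP gB) //.
  by rewrite (inj_eq perm_inj) eq_sym.
- have := cardsID [set v; w] (active g :&: bottom).
  have -> : active g :&: bottom :&: [set v; w] = [set v; w].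
    apply/setIidPr; rewrite (setIidPl gB).
    by rewrite subUset !sub1set v_act w_act.
  by rewrite setIDAC cards2 eq_sym wv => e; move: g_even; rewrite -e oddD.
Qed.

Lemma S_alpha_Aut : <<S_alpha k>>%g \subset Aut_tree k.
Proof.
rewrite gen_subG subUset sub1set tree_aut_Aut andbT.
by apply/subsetP=> _ /imsetP[l _ ->]; apply: tree_aut_Aut.
Qed.

Lemma S_alpha_generates_G : <<S_alpha k>>%g = G k.
Proof.
apply/eqP; rewrite eqEsubset gen_subG join_subG; apply/and3P; split.
- rewrite subUset sub1set; apply/andP; split.
    apply/subsetP=> _ /imsetP[l _ ->]; apply/mem_gen/setUP; left.
    rewrite inE tree_aut_Aut /=; apply/forall_inP=> v.
    rewrite active_tree_aut inE vtx_leftmost inE => /andP[_ /eqP->].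
    by rewrite size_nseq ltn_eqF.
  apply/mem_gen/setUP; right; rewrite tauE inE activate_Aut /=.
  rewrite active_activate ?pair_inner ?const_vertex_bottom //.
  apply/andP; split.
    apply/forall_inP=> v; rewrite !inE.
    by case/orP=> /eqP->; rewrite const_vertexE size_nseq.
  by rewrite cards2 const_vertex_neq.
- apply/subsetP=> g /setIdP[gA /forall_inP gB]; apply: even_bottom_gen => //.
  suff -> : active g :&: bottom = set0 by rewrite cards0.
  apply/setP=> v; rewrite inE in_set0; apply/negP=> /andP[/gB vN].
  by rewrite inE (negPf vN).
- apply/subsetP=> g /setIdP[gA /andP[/forall_inP gB g_even]].
  apply: even_bottom_gen => //.
  by rewrite (setIidPl _) //; apply/subsetP=> v /gB; rewrite inE.
Qed.

End Generation.

(** * Parity and the order of Aut X^[k] on the leaves *)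

(** The permutation p splits into its restriction q to A and the conjugate of
    q by s, and these two factors have the same parity. *)
Lemma even_perm_commute (T : finType) (p s : {perm T}) (A : {set T}) :
    commute p s -> (forall x, (p x \in A) = (x \in A)) ->
    (forall x, (s x \in A) = (x \notin A)) ->
  ~~ odd_perm p.
Proof.
move=> ps pA sA; pose q := restr_perm A p.
have pN : p \in 'N(A | 'P)%g.
  by rewrite !inE; apply/subsetP=> x xA; rewrite inE /= apermE pA.
have qE x : x \in A -> q x = p x by exact: restr_permE.
have qN x : x \notin A -> q x = x by exact: out_perm (restr_perm_on A p).
suff -> : p = (q * q ^ s)%g by rewrite odd_permM odd_permJ addbb.
apply/permP=> x; rewrite permM; have [y ->] : exists y, x = s y.
  by exists (s^-1%g x); rewrite permKV.
have sp z : p (s z) = s (p z) by rewrite -!permM ps.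
have [yA|yA] := boolP (s y \in A).
  by rewrite qE // sp permJ qN // -sA -sp pA.
by rewrite (qN (s y)) // permJ qE ?sp // -[_ \in A]negbK -sA.
Qed.

(** Legendre: the sum of the 2^(k - i) for i from 1 to k; later terms vanish. *)
Lemma logn2_fact_exp k : logn 2 (2 ^ k)`! = (2 ^ k).-1.
Proof.
have k_lt : k < (2 ^ k).+1 by rewrite ltnS ltnW // ltn_expl.
rewrite logn_fact // (@big_cat_nat _ _ _ k.+1) //= [X in _ + X]big_nat_cond.
rewrite [X in _ + X]big1 ?addn0 => [|i /andP[/andP[i_gt _] _]]; last first.
  by rewrite divn_small // ltn_exp2l.
rewrite predn_exp mul1n big_add1 big_mkord /= (reindex_inj rev_ord_inj) /=.
apply: eq_bigr => i _; rewrite subnSK //.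
have -> : 2 ^ k = 2 ^ i * 2 ^ (k - i) by rewrite -expnD subnKC // ltnW.
by rewrite mulnK ?expn_gt0.
Qed.

Section LeafAction.

Variable k : nat.
Implicit Types (u v w : vertex k) (g h : {perm vertex k}) (x : bool).

Definition leaves : {set vertex k} := [set v : vertex k | size v == k].

Lemma leftmost_leaf : insub_bseq k (nseq k false) \in leaves.
Proof. by rewrite inE /insub_bseq insubdK -?topredE /= size_nseq. Qed.

Lemma card_leaves : #|leaves| = 2 ^ k.
Proof.
rewrite -card_bool -card_tuple -cardsT -(card_imset _ (f := @bseq_of_tuple k bool)).
  apply: eq_card => v; rewrite inE; apply/eqP/imsetP=> [vk|[t _ ->]].
    by exists (tcast vk (in_tuple v)) => //; apply/val_inj; rewrite /= val_tcast.
  exact: size_tuple.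
by move=> s t /(congr1 val) /= /val_inj.
Qed.

Lemma card_inner : #|inner k| = (2 ^ k).-1.
Proof.
have := cardsID leaves [set: vertex k]; rewrite setTI setTD card_leaves.
have -> : ~: leaves = inner k.
  by apply/setP=> v; rewrite !inE ltn_neqAle size_bseq andbT.
rewrite cardsT card_bseq card_bool big_ord_recr /= addnC.
move/addIn ->; by rewrite predn_exp mul1n.
Qed.

(** Portraits are exactly the sets of inner vertices. *)
Lemma card_Aut_tree : #|Aut_tree k| = 2 ^ (2 ^ k).-1.
Proof.
rewrite -card_inner -card_powerset -(card_in_imset (@active_inj k)).
apply: eq_card => A; rewrite inE; apply/imsetP/idP=> [[g _ ->]|sA].
  exact: active_inner.
by exists (activate A); rewrite ?activate_Aut ?active_activate.
Qed.

Lemma leafP v : 0 < k -> v \in leaves ->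
  exists2 w, w \in bottom k & exists x, v = child w x.
Proof.
rewrite inE => k_gt0; elim/vertex_ind: v => [|w x w_lt _]; first by rewrite ltn_eqF.
rewrite child_val // size_rcons => /eqP wk; exists w; last by exists x.
by rewrite inE -eqSS prednK // wk.
Qed.

(** The value outside of Aut X^[k] only serves to make this injective for every
    g, as the construction of a permutation requires. *)
Definition leaf_fun g (i : 'I_#|leaves|) : 'I_#|leaves| :=
  if g \in Aut_tree k then enum_rank_in leftmost_leaf (g (enum_val i)) else i.

Lemma leaf_funE g i : g \in Aut_tree k ->
  enum_val (leaf_fun g i) = g (enum_val i).
Proof.
move=> gA; rewrite /leaf_fun gA enum_rankK_in // inE Aut_size //.
by have := enum_valP i; rewrite inE.
Qed.

Lemma leaf_fun_inj g : injective (leaf_fun g).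
Proof.
case gA: (g \in Aut_tree k); last by rewrite /leaf_fun gA.
by move=> i j /(congr1 enum_val); rewrite !leaf_funE // => /perm_inj/enum_val_inj.
Qed.

Definition leaf_perm g : {perm 'I_#|leaves|} := perm (@leaf_fun_inj g).

Lemma leaf_permE g i : g \in Aut_tree k ->
  enum_val (leaf_perm g i) = g (enum_val i).
Proof. by move=> gA; rewrite permE leaf_funE. Qed.

Lemma leaf_permM : {in Aut_tree k &, {morph leaf_perm : g h / (g * h)%g}}.
Proof.
move=> g h gA hA; apply/permP=> i; apply: enum_val_inj.
by rewrite permM !leaf_permE ?groupM // permM.
Qed.
Canonical leaf_perm_morphism := Morphism leaf_permM.

(** An automorphism that fixes a child of v fixes v, so fixing the leaves
    propagates up to the root. *)
Lemma injm_leaf_perm : ('injm leaf_perm)%g.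
Proof.
apply/subsetP=> g /morphpreP[gA /set1P g1]; apply/set1P/permP=> v; rewrite perm1.
have [n] := ubnP (k - size v); elim: n v => // n IHn v v_gt.
case: (ltnP (size v) k) => v_lt; last first.
  have vL : v \in leaves by rewrite inE eqn_leq size_bseq.
  by rewrite -(enum_rankK_in vL vL) -leaf_permE // g1 perm1.
have e : g (child v false) = child v false.
  apply: IHn; rewrite child_val // size_rcons subnS -ltnS prednK //.
  by rewrite subn_gt0.
have := congr1 val e; rewrite /= Aut_child // child_val // => /rcons_inj[v_fix _].
exact: val_inj.
Qed.

Lemma leaf_perm_Sylow_Sym :
  2.-Sylow('Sym_('I_#|leaves|))%g (leaf_perm @* Aut_tree k)%g.
Proof.
rewrite pHallE subsetT card_injm ?injm_leaf_perm //= card_Aut_tree card_Sym card_ord.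
by rewrite card_leaves p_part logn2_fact_exp.
Qed.

End LeafAction.

Section Parity.

Variable k : nat.
Hypothesis k_ge2 : 2 <= k.
Implicit Types (u v w : vertex k) (g h : {perm vertex k}) (x : bool).

Let k_gt0 : 0 < k. Proof. exact: ltnW. Qed.

(** The automorphism s active on all of X^(k-1) switches the last letter of
    every leaf; it commutes with h, which keeps last letters. *)
Lemma even_leaf_perm_upper h : h \in Aut_tree k ->
    {in active h, forall v : vertex k, size v < k.-1} ->
  ~~ odd_perm (leaf_perm h).
Proof.
move=> hA h_up; pose s := activate (bottom k).
have sA : s \in Aut_tree k := activate_Aut _.
have act_s : active s = bottom k by rewrite active_activate ?bottom_inner.
pose A : {set 'I_#|leaves k|} :=
  [set i : 'I_#|leaves k| | last true (enum_val i)].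
have leaf_last g (i : 'I_#|leaves k|) : g \in Aut_tree k ->
    exists2 w, w \in bottom k &
      (leaf_perm g i \in A) = (i \in A) (+) (w \in active g).
  move=> gA; have [w wB [x e]] := leafP k_gt0 (enum_valP i); exists w => //.
  have w_lt : size w < k by move: (subsetP (bottom_inner k_ge2) w wB); rewrite inE.
  by rewrite ![_ \in A]in_set leaf_permE // e Aut_child // child_val // !last_rcons.
apply: (@even_perm_commute _ (leaf_perm h) (leaf_perm s) A) => [|i|i].
- suff sJ : (s ^ h = s)%g by rewrite /commute -!leaf_permM // [(s * h)%g]conjgC sJ.
  apply: active_inj; rewrite ?groupJ // (@active_conj _ k.-1) // act_s.
    apply/setP=> v; rewrite -[v](permKV h) mem_imset; last exact: perm_inj.
    by rewrite (Aut_bottom _ hA).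
  by move=> v; rewrite inE => /eqP->.
- have [w wB ->] := leaf_last h i hA; rewrite (_ : w \in active h = false) ?addbF //.
  by apply/negP=> /h_up; move: wB; rewrite inE => /eqP->; rewrite ltnn.
- by have [w wB ->] := leaf_last s i sA; rewrite act_s wB addbT.
Qed.

Lemma odd_leaf_perm_flip u : u \in bottom k -> odd_perm (leaf_perm (activate [set u])).
Proof.
move=> uB; have u_in := subsetP (bottom_inner k_ge2) u uB.
have u_lt : size u < k by rewrite inE in u_in.
set g := activate _; have gA : g \in Aut_tree k := activate_Aut _.
have act_g : active g = [set u] by rewrite active_activate ?sub1set.
have leaf x : child u x \in leaves k.
  by rewrite inE child_val // size_rcons; move: uB; rewrite inE => /eqP->; rewrite prednK.
pose i x := enum_rank_in (leaf x) (child u x).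
have iE x : enum_val (i x) = child u x by rewrite enum_rankK_in.
have g_fix w : w \in bottom k -> g w = w by apply: bottom_fix; rewrite ?sub1set.
suff -> : leaf_perm g = tperm (i false) (i true).
  rewrite odd_tperm; apply: contraTneq (erefl true) => /(congr1 enum_val).
  by rewrite !iE => /(congr1 val); rewrite /= !child_val // => /rcons_inj[].
apply/permP=> j; apply: enum_val_inj; rewrite leaf_permE //.
have [w wB [x e]] := leafP k_gt0 (enum_valP j).
have w_lt : size w < k by move: (subsetP (bottom_inner k_ge2) w wB); rewrite inE.
have gj : g (enum_val j) = child w (x (+) (w == u)).
  by apply/val_inj; rewrite /= e Aut_child // act_g inE g_fix // child_val.
have [wu|wu] := eqVneq w u.
  have -> : j = i x by apply: enum_val_inj; rewrite iE e wu.
  rewrite iE -wu -e gj wu eqxx addbT.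
  by case: (x); rewrite ?tpermL ?tpermR iE.
have ij b : i b != j.
  apply: contraNneq wu => /(congr1 enum_val); rewrite iE e => /(congr1 val).
  by rewrite /= !child_val // => /rcons_inj[/val_inj->].
by rewrite tpermD // gj (negPf wu) addbF e.
Qed.

(** If g is not in the group, its portrait meets X^(k-1) in an odd number of
    vertices; composing with a single switch on X^(k-1), which is odd on the
    leaves, lands in the group, which is even on the leaves. *)
Lemma leaf_perm_in_Alt g : g \in Aut_tree k ->
  (leaf_perm g \in 'Alt_('I_#|leaves k|))%g = (g \in <<S_alpha k>>)%g.
Proof.
have gen_even h : (h \in <<S_alpha k>>)%g -> ~~ odd_perm (leaf_perm h).
  move=> hK; rewrite -Alt_even.
  suff /subsetP/(_ h hK) :
      (<<S_alpha k>> \subset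
         leaf_perm_morphism k @*^-1 'Alt_('I_#|leaves k|))%g.
    by case/morphpreP.
  rewrite gen_subG; apply/subsetP=> s sS; apply/morphpreP.
  have sA := subsetP (S_alpha_Aut k) s (mem_gen sS).
  split; rewrite //= Alt_even.
  case/setUP: sS => [/imsetP[l _ ->]|/set1P->].
    apply: even_leaf_perm_upper => [|v]; first exact: tree_aut_Aut.
    by rewrite active_tree_aut vtx_leftmost inE mem_seq1 => /andP[_ /eqP->];
       rewrite size_nseq.
  rewrite tauE // (_ : [set _; _] =
    [set v | (v \in [set const_vertex k false])
             (+) (v \in [set const_vertex k true])]).
    rewrite -activate_bottomM ?sub1set ?const_vertex_bottom //.
    rewrite leaf_permM ?activate_Aut // odd_permM.
    by rewrite !odd_leaf_perm_flip ?const_vertex_bottom.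
  apply/setP=> v; rewrite !inE; have [->|_] //= := eqVneq v (const_vertex k false).
  by rewrite (negPf (const_vertex_neq k_ge2)).
move=> gA; rewrite Alt_even; apply/idP/idP=> [g_even|]; last exact: gen_even.
have [g_odd|] := boolP (odd #|active g :&: bottom k|); last exact: even_bottom_gen.
set v := const_vertex k true; have vB : v \in bottom k := const_vertex_bottom k true.
pose t := activate [set g v]; have tA : t \in Aut_tree k := activate_Aut _.
suff /gen_even : (g * t \in <<S_alpha k>>)%g.
  by rewrite leaf_permM // odd_permM (negPf g_even) odd_leaf_perm_flip ?Aut_bottom.
apply: even_bottom_gen; rewrite ?groupM //.
have -> : active (g * t)%g = [set w | (w \in active g) (+) (w \in [set v])].
  by rewrite -active_mul_activate ?imset_set1 ?sub1set ?(subsetP (bottom_inner k_ge2)).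
set C := _ :&: bottom k; have CD : C :\ v = (active g :&: bottom k) :\ v.
  apply/setP=> w; rewrite !in_setD !in_setI in_set in_set1.
  by case: (w == v); rewrite ?addbF.
have vC : (v \in C) = (v \notin active g :&: bottom k).
  by rewrite !in_setI in_set in_set1 vB eqxx addbT !andbT.
move: g_odd; rewrite (cardsD1 v) (cardsD1 v C) CD vC !oddD !oddb.
by case: (v \in _); case: (odd _).
Qed.

End Parity.

Theorem theorem2 (k : nat) (hk : 2 <= k) :
  <<S_alpha k>> = G k /\
  exists2 P : {group {perm 'I_(2 ^ k)}},
    P \in 'Syl_2('Alt_('I_(2 ^ k))) & G k \isog P.
Proof.
split; first exact: S_alpha_generates_G.
rewrite -(card_leaves k) -(group_inj (S_alpha_generates_G hk) : <<S_alpha k>>%G = G k).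
exists (leaf_perm_morphism k @* <<S_alpha k>>)%G; last first.
  exact: sub_isog (S_alpha_Aut k) (injm_leaf_perm k).
rewrite inE /=.
have -> : (leaf_perm_morphism k @* <<S_alpha k>> =
    leaf_perm_morphism k @* Aut_tree k :&: 'Alt_('I_#|leaves k|))%g.
  apply/setP=> p; rewrite inE.
  apply/morphimP/andP=> [[g gA gK ->]|[/morphimP[g gA _ ->]]].
    by rewrite mem_morphim ?leaf_perm_in_Alt.
  by rewrite leaf_perm_in_Alt // => gK; exists g.
exact: Hall_setI_normal (Alt_normal _) (leaf_perm_Sylow_Sym k).
Qed.
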